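(* Let $(\epsilon_k)_{k\ge 1}$ be any sequence of positive real numbers converging to zero, and regard each $D_{\epsilon_k}$ as an operator from $L^2(\mathbb{T})$ to $L^2(\mathbb{T})$. Then $$\sum_{k=1}^{\infty}\left\|D_{\epsilon_{k+1}}-D_{\epsilon_k}\right\|_2=\infty,$$ where $\|\cdot\|_2$ denotes the operator norm on $L^2(\mathbb{T})$.
   Context: $\mathbb{T}=\{z\in\mathbb{C}:|z|=1\}$. For $\epsilon>0$ and $f\in L^2(\mathbb{T})$, $D_\epsilon f(e^{ix})=\frac{1}{2\epsilon}\int_{-\epsilon}^{\epsilon} f(e^{i(x-y)})\,dy$. Equivalently, $D_\epsilon$ is the Fourier multiplier operator $\widehat{D_\epsilon f}(\ell)=\frac{\sin(\ell\epsilon)}{\ell\epsilon}\widehat f(\ell)$, $\ell\in\mathbb{Z}$ (the multiplier being $1$ at $\ell=0$). *)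

(* Defs.v *)
From HB Require Import structures.
From mathcomp Require Export all_boot all_order all_algebra.
From mathcomp Require Export all_classical all_reals all_analysis.
From mathcomp Require Export complex.

Set Implicit Arguments.
Unset Strict Implicit.
Unset Printing Implicit Defensive.

Import Order.TTheory GRing.Theory Num.Theory.
Import numFieldNormedType.Exports.

Local Open Scope classical_set_scope.
Local Open Scope ring_scope.
Local Open Scope complex_scope.

Definition circle (R : realType) := {z : R[i] | `|z| == 1}.

Lemma expi_subproof (R : realType) (x : R) : `|cos x +i* sin x| == 1 :> R[i].
Proof. by rewrite normc_def /= cos2Dsin2 sqrtr1. Qed.

(* e^{ix} *)
Definition expi (R : realType) (x : R) : circle R :=
  exist (fun z => is_true (`|z| == 1)) _ (expi_subproof x).

Lemma circle_mul_subproof (R : realType) (z w : circle R) :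
  `|val z * val w| == 1.
Proof. by rewrite normrM (eqP (valP z)) (eqP (valP w)) mulr1. Qed.

Definition circle_mul (R : realType) (z w : circle R) : circle R :=
  exist (fun u => is_true (`|u| == 1)) _ (circle_mul_subproof z w).

Lemma expiD (R : realType) (x y : R) :
  expi (x + y) = circle_mul (expi x) (expi y).
Proof.
by apply: val_inj; rewrite /= cosD sinD; apply/eqP; rewrite eq_complex /= eqxx /= addrC.
Qed.

(* D_eps f (z) = (2 eps)^-1 \int_{-eps}^{eps} f (z e^{-iy}) dy; the integral of
   a complex-valued function is taken on the real and imaginary parts. *)
Definition average (R : realType) (eps : R) (f : circle R -> R[i]) :
    circle R -> R[i] :=
  fun z =>
    ((2 * eps)^-1)%:C *
    ((\int[lebesgue_measure]_(y in `[- eps, eps])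
        complex.Re (f (circle_mul z (expi (- y))))) +i*
     (\int[lebesgue_measure]_(y in `[- eps, eps])
        complex.Im (f (circle_mul z (expi (- y)))))).

Lemma average_expi (R : realType) (eps x : R) (f : circle R -> R[i]) :
  average eps f (expi x) =
    ((2 * eps)^-1)%:C *
    ((\int[lebesgue_measure]_(y in `[- eps, eps]) complex.Re (f (expi (x - y)))) +i*
     (\int[lebesgue_measure]_(y in `[- eps, eps]) complex.Im (f (expi (x - y))))).
Proof.
by rewrite /average; congr (_ * (_ +i* _)); apply: eq_Rintegral => y _;
  rewrite expiD.
Qed.

Lemma ltNpi (R : realType) : - pi < pi :> R.
Proof. by rewrite gtrN// pi_gt0. Qed.

(* The norm of L^2(T) for the normalized arc-length measure, i.e. the image of
   the uniform probability on [-pi, pi] under x |-> e^{ix}.  It is defined on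
   functions; functions equal a.e. have the same norm. *)
Definition L2norm (R : realType) (f : circle R -> R[i]) : \bar R :=
  Lnorm (uniform_prob (ltNpi R)) 2%:E (fun x => (Normc.normc (f (expi x)))%:E).

Definition in_L2 (R : realType) (f : circle R -> R[i]) : Prop :=
  [/\ measurable_fun setT (fun x : R => complex.Re (f (expi x))),
      measurable_fun setT (fun x : R => complex.Im (f (expi x))) &
      (L2norm f < +oo)%E].

(* The supremum runs over representatives rather than a.e. classes.  It is the
   same number whenever A respects a.e. equality, as averages do: they are
   integrals of translates of f.  A value of +oo means that A is unbounded. *)
Definition opnorm (R : realType)
    (A : (circle R -> R[i]) -> (circle R -> R[i])) : \bar R :=
  ereal_sup [set L2norm (A f) | f in [set f | in_L2 f /\ (L2norm f <= 1)%E]].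

(* Main.v *)
Require Import Defs.
From mathcomp Require Import ring lra measurable_realfun.
Import Order.TTheory GRing.Theory Num.Theory.
Import numFieldNormedType.Exports.
Local Open Scope classical_set_scope.
Local Open Scope ring_scope.
Local Open Scope complex_scope.

(** The averages converge to the identity strongly but not in operator norm,
    and a telescoping series whose norms were summable would converge in
    operator norm.

    Concretely, every character z |-> z ^ l with l > 0 is an eigenvector of
    D_e with eigenvalue sinc (l e), where sinc t = sin t / t, and it has L^2
    norm 1 ([average_circle_pow], [L2norm_cst_modulus]).  Hence
      |sinc (l a) - sinc (l b)| <= ||D_a - D_b||
    for each l > 0 ([opnorm_average_sub_ge]).  Fix N.  Since sinc vanishes at
    infinity, some l makes |sinc (l eps_N)| <= 1/4 ([sinc_small]).  With this
    l kept fixed, eps_n -> 0 and sinc t -> 1 as t -> 0 ([cvg_sinc0]), so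
    sinc (l eps_n) > 3/4 for some n >= N.  By the triangle inequality the
    partial sum of the norms from N to n is at least 1/2.  As N is arbitrary,
    the tails of the series do not tend to 0, so the series diverges
    ([nneseries_tail_big_pinfty]). *)

(** * Averages of the characters of the circle *)

Definition sinc {R : realType} (t : R) : R := sin t / t.

Definition circle_pow {R : realType} (l : nat) (z : circle R) : R[i] :=
  val z ^+ l.

Lemma circle_pow_expi (R : realType) (l : nat) (x : R) :
  circle_pow l (expi x) = cos (l%:R * x) +i* sin (l%:R * x).
Proof.
elim: l => [|l IHl]; first by rewrite /circle_pow expr0 mul0r cos0 sin0.
rewrite /circle_pow exprS -/(circle_pow l (expi x)) IHl /= -natr1 mulrDl mul1r.
rewrite (addrC (l%:R * x)) cosD sinD; apply/eqP; rewrite eq_complex /= eqxx /=.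
by rewrite addrC.
Qed.

Lemma Rintegral_FTC2 (R : realType) (f F : R -> R) (a b : R) :
  a < b -> continuous f -> (forall x, is_derive x (1 : R) F (f x)) ->
  \int[lebesgue_measure]_(y in `[a, b]) f y = F b - F a.
Proof.
move=> ab fc dF; have cF : continuous F.
  by move=> x; apply: differentiable_continuous; apply/derivable1_diffP; apply: ex_derive.
rewrite /Rintegral (continuous_FTC2 ab (F := F)) //.
- exact: continuous_subspaceT.
- split; first by move=> x _; apply: ex_derive.
  + by apply: cvg_at_right_filter; exact: cF.
  + by apply: cvg_at_left_filter; exact: cF.
- by move=> x _; rewrite derive1E; apply: derive_val.
Qed.

(** The primitive - sin (c (x - y)) / c evaluated at both ends gives
    (sin (c (x + e)) - sin (c (x - e))) / c, and the addition formula turns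
    this difference into 2 sin (c e) cos (c x) / c. *)
Lemma integral_cos_shift (R : realType) (c e x : R) : c != 0 -> 0 < e ->
  \int[lebesgue_measure]_(y in `[- e, e]) cos (c * (x - y)) =
  2 * e * (sinc (c * e) * cos (c * x)).
Proof.
move=> c0 e0.
have dF y : is_derive y (1 : R) (fun y => - sin (c * (x - y)) / c) (cos (c * (x - y))).
  apply: is_derive_eq; rewrite /GRing.scale /=.
  by field.
have fc : continuous (fun y => cos (c * (x - y))).
  move=> y; apply: continuous_comp; last exact: continuous_cos.
  by apply: cvgM; [exact: cvg_cst|apply: cvgB; [exact: cvg_cst|exact: cvg_id]].
have ee : - e < e by rewrite gtrN.
rewrite (Rintegral_FTC2 _ _ _ _ _ ee fc dF) /sinc opprK mulrBr mulrDr sinB sinD.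
by field; rewrite c0 gt_eqF.
Qed.

Lemma integral_sin_shift (R : realType) (c e x : R) : c != 0 -> 0 < e ->
  \int[lebesgue_measure]_(y in `[- e, e]) sin (c * (x - y)) =
  2 * e * (sinc (c * e) * sin (c * x)).
Proof.
move=> c0 e0.
have dF y : is_derive y (1 : R) (fun y => cos (c * (x - y)) / c) (sin (c * (x - y))).
  apply: is_derive_eq; rewrite /GRing.scale /=.
  by field.
have fc : continuous (fun y => sin (c * (x - y))).
  move=> y; apply: continuous_comp; last exact: continuous_sin.
  by apply: cvgM; [exact: cvg_cst|apply: cvgB; [exact: cvg_cst|exact: cvg_id]].
have ee : - e < e by rewrite gtrN.
rewrite (Rintegral_FTC2 _ _ _ _ _ ee fc dF) /sinc opprK mulrBr mulrDr cosB cosD.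
by field; rewrite c0 gt_eqF.
Qed.

(** Translations act on a character by scalars, so averaging over translations
    does too; the scalar is the average of e^{-ily} over [-e, e].  The case
    l = 0 is excluded because sinc is 0, not 1, at 0 under the convention
    x / 0 = 0. *)
Lemma average_circle_pow (R : realType) (l : nat) (e x : R) : (0 < l)%N -> 0 < e ->
  average e (circle_pow l) (expi x) =
  (sinc (l%:R * e))%:C * circle_pow l (expi x).
Proof.
move=> l0 e0; rewrite average_expi circle_pow_expi.
have ln0 : l%:R != 0 :> R by rewrite pnatr_eq0 -lt0n.
under eq_Rintegral do rewrite circle_pow_expi /=.
under [X in _ +i* X]eq_Rintegral do rewrite circle_pow_expi /=.
rewrite integral_cos_shift// integral_sin_shift//.
apply/eqP; rewrite eq_complex /=; apply/andP; split; apply/eqP; field; exact: lt0r_neq0.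
Qed.

(** * Lower bound for the operator norms *)

(** Only the modulus enters the L^2 norm, and the measure has total mass 1. *)
Lemma L2norm_cst_modulus (R : realType) (f : circle R -> R[i]) (c : R) :
  0 <= c -> (forall x, Normc.normc (f (expi x)) = c) -> L2norm f = c%:E.
Proof.
move=> c0 fc; rewrite /L2norm unlock /Lnorm.
under eq_integral do rewrite fc.
have PT := @probability_setT _ _ _ (uniform_prob (ltNpi R)).
rewrite integral_cst// [X in (_ * X)%E]PT mule1 poweR_EFin -powRrM mulfV//.
by rewrite powRr1// ger0_norm.
Qed.

(** The character z ^ l is a unit vector, and the difference of the averages
    multiplies it by the difference of the two eigenvalues. *)
Lemma opnorm_average_sub_ge (R : realType) (a b : R) (l : nat) :
  (0 < l)%N -> 0 < a -> 0 < b ->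
  (`|sinc (l%:R * a) - sinc (l%:R * b)|%:E
     <= opnorm (average a - average b)%R)%E.
Proof.
move=> l0 a0 b0.
have normE (x : R) : Normc.normc (circle_pow l (expi x)) = 1.
  by rewrite circle_pow_expi /= cos2Dsin2 sqrtr1.
have norm1 : L2norm (@circle_pow R l) = 1%:E by exact: (L2norm_cst_modulus _ _ _ ler01 normE).
apply: ereal_sup_ubound; exists (@circle_pow R l) => /=.
  split; last by rewrite norm1.
  split; last by rewrite norm1 ltry.
  - under eq_fun do rewrite circle_pow_expi /=.
    apply: continuous_measurable_fun => x.
    by apply: continuous_comp; [exact: mulrl_continuous|exact: continuous_cos].
  - under eq_fun do rewrite circle_pow_expi /=.
    apply: continuous_measurable_fun => x.
    by apply: continuous_comp; [exact: mulrl_continuous|exact: continuous_sin].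
apply: L2norm_cst_modulus => // x.
rewrite [X in Normc.normc X](_ : _ = (sinc (l%:R * a) - sinc (l%:R * b))%:C
  * circle_pow l (expi x)).
  by rewrite Normc.normcM normE mulr1 /= expr0n addr0 sqrtr_sqr.
by rewrite rmorphB mulrBl -!average_circle_pow.
Qed.

Lemma opnorm_average_sub_ge0 (R : realType) (a b : R) : 0 < a -> 0 < b ->
  (0 <= opnorm (average a - average b)%R)%E.
Proof.
by move=> a0 b0; apply: le_trans (@opnorm_average_sub_ge R a b 1 _ a0 b0).
Qed.

(** * The two limits of the multiplier *)

(** The quotient sin t / t is the difference quotient of sin at 0. *)
Lemma cvg_sinc0 (R : realType) : sinc t @[t --> (0 : R)^'] --> (1 : R).
Proof.
have ds := @is_derive_sin R 0.
have : derivable sin (0 : R) 1 by apply: ex_derive.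
rewrite /derivable -[lim _]/('D_1 sin (0 : R)) derive_val cos0.
apply: cvg_trans; apply: near_eq_cvg; near=> h.
by rewrite /= addr0 sin0 subr0 [h%:A]mulr1 /sinc mulrC.
Unshelve. all: by end_near. Qed.

(** As |sin| <= 1, it suffices that l e >= 4. *)
Lemma sinc_small (R : realType) (e : R) : 0 < e ->
  exists2 l : nat, (0 < l)%N & `|sinc (l%:R * e)| <= 4^-1.
Proof.
move=> e0; exists (Num.bound (4 / e)).+1 => //.
set t := _ * e; have t4 : 4 <= t.
  rewrite -ler_pdivrMr//; apply: le_trans (ltW (archi_boundP _)) _.
    by rewrite divr_ge0// ltW.
  by rewrite ler_nat.
have t0 : 0 < t by lra.
rewrite normrM normfV (gtr0_norm t0) ler_pdivrMr//.
apply: (@le_trans _ _ 1); last lra.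
by rewrite ler_norml sin_geN1 sin_le1.
Qed.

(** * Divergence *)

(** The tails of a convergent series of nonnegative terms tend to 0, so they
    cannot all contain a block of sum at least d. *)
Lemma nneseries_tail_big_pinfty (R : realType) (u : nat -> \bar R) (d : R) :
  0 < d -> (forall k, (1 <= k)%N -> (0 <= u k)%E) ->
  (forall N, (1 <= N)%N ->
     exists2 n, (N <= n)%N & (d%:E <= \sum_(N <= k < n) u k)%E) ->
  (\sum_(1 <= k <oo) u k = +oo)%E.
Proof.
move=> d0 u0 large; apply/eqP; rewrite eq_le leey /= leNgt; apply/negP => fin.
rewrite eseries_cond /= in fin; have cv := nneseries_tail_cvg fin u0.
have d_nbhs : nbhs (0 : \bar R)%E [set y | (y < d%:E)%E].
  by apply: open_ereal_lt'; rewrite lte_fin.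
have {cv} := cv _ d_nbhs.
case=> N _ /(_ N.+1 (leqnSn _)) /=; apply/negP; rewrite -leNgt.
have [n Nn dn] := large N.+1 isT; apply: (le_trans dn).
rewrite big_nat_cond [leLHS](_ : _ = \sum_(N.+1 <= k < n | (0 < k)%N) u k)%E.
  by apply: nneseries_lim_ge => k _; exact: u0.
rewrite [RHS]big_nat_cond; apply: eq_bigl => k.
by case: k.
Qed.

Theorem theorem2p6 (R : realType) (eps : nat -> R)
    (eps_gt0 : forall k : nat, (1 <= k)%N -> 0 < eps k)
    (eps_cvg0 : eps k @[k --> \oo] --> (0 : R)) :
  (\sum_(1 <= k <oo) opnorm (average (eps k.+1) - average (eps k))%R = +oo)%E.
Proof.
apply: (@nneseries_tail_big_pinfty _ _ 2^-1) => //.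
  by move=> k k1; apply: opnorm_average_sub_ge0; exact: eps_gt0.
move=> N N1; have [l l0 lN] := @sinc_small R (eps N) (eps_gt0 N N1).
have : sinc (l%:R * eps k) @[k --> \oo] --> (1 : R).
  apply: cvg_comp (@cvg_sinc0 R).
  have le0 : l%:R * eps k @[k --> \oo] --> (0 : R).
    by rewrite -(mulr0 l%:R); apply: cvgMr.
  (* sinc t tends to 1 along the punctured neighbourhoods of 0 only, since
     sinc 0 = 0; positivity of eps_k keeps l eps_k away from 0. *)
  move=> A /le0 nA.
  have : \forall k \near \oo, l%:R * eps k != 0 -> A (l%:R * eps k) by exact: nA.
  move=> {}nA; apply: filterS2 nA (nbhs_infty_ge 1) => k nAk k1.
  by apply: nAk; apply: lt0r_neq0; rewrite mulr_gt0 ?ltr0n// eps_gt0.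
move=> /cvgr_gt /(_ (3 / 4)) []; first lra.
move=> m _ hm; set n := maxn N m.
have Nn : (N <= n)%N by exact: leq_maxl.
exists n => //; apply: (@le_trans _ _ `|sinc (l%:R * eps n) - sinc (l%:R * eps N)|%:E).
  have := hm n (leq_maxr _ _) => /= hn.
  rewrite lee_fin; apply: le_trans (ler_norm _).
  move: lN; rewrite ler_norml => /andP[_ ?]; lra.
(* sinc (l eps_n) - sinc (l eps_N) is the telescoping sum of increments, each
   of which is at most an operator norm. *)
rewrite -(telescope_sumr (fun k => sinc (l%:R * eps k)) Nn).
apply: (@le_trans _ _ (\sum_(N <= k < n) `|sinc (l%:R * eps k.+1) - sinc (l%:R * eps k)|)%:E).
  by rewrite lee_fin; exact: ler_norm_sum.
rewrite -sumEFin big_nat_cond [leRHS]big_nat_cond; apply: lee_sum => k /andP[/andP[Nk _] _].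
have k1 := leq_trans N1 Nk.
by apply: opnorm_average_sub_ge; rewrite ?eps_gt0.
Qed.
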